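(* Let $\mathbf A=(A,\leq)$ be a poset and $S$ a non-empty subset of $A$. Then $\mathbf P_S(\mathbf A)$ is a pseudo-Kleene poset and \begin{align*} L(X)&=\big(L(p_1(X))\times U(p_2(X))\big)\cap P_S(\mathbf A),\\ U(X)&=\big(U(p_1(X))\times L(p_2(X))\big)\cap P_S(\mathbf A) \end{align*} for all $X\subseteq P_S(\mathbf A)$, where on the left-hand sides $L,U$ are computed in $\big(P_S(\mathbf A),\sqsubseteq\big)$ and on the right-hand sides in $\mathbf A$.
   Context: In a poset $(A,\leq)$, for $B,C\subseteq A$, $B\leq C$ means $x\leq y$ for all $x\in B$, $y\in C$. $L(B)=\{x\in A\mid x\leq B\}$, $U(B)=\{x\in A\mid B\leq x\}$, $L(b,c)=L(\{b,c\})$, $U(b,c)=U(\{b,c\})$. An antitone involution is a unary operation ${}'$ with $x\leq y\Rightarrow y'\leq x'$ and $x''=x$. A pseudo-Kleene poset is a poset with an antitone involution ${}'$ such that $L(x,x')\leq U(y,y')$ for all $x,y$. For a non-empty subset $S\subseteq A$, $P_S(\mathbf A)=\{(x,y)\in A^2\mid L(x,y)\leq S\leq U(x,y)\}$, and $\mathbf P_S(\mathbf A)=\big(P_S(\mathbf A),\sqsubseteq,{}'\big)$, where $(x,y)\sqsubseteq(z,u)$ iff $x\leq z$ and $u\leq y$, and $(x,y)'=(y,x)$. $p_1,p_2$ are the first and second projections from $P_S(\mathbf A)$ to $A$. *)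

(* Defs.v *)
From mathcomp Require Import all_boot all_order.
From mathcomp Require Import boolp classical_sets.

Set Implicit Arguments.
Unset Strict Implicit.
Unset Printing Implicit Defensive.

Import Order.TTheory.
Local Open Scope order_scope.
Local Open Scope classical_set_scope.

(* The cones are taken with respect to an explicit relation [r], so that the   *)
(* same definitions apply to a [porderType] (with [r := <=%O]) and to a        *)
(* relation whose poset axioms are still to be proved.                         *)
Section Relations.
Variables (T : Type) (r : rel T).

Definition lower_cone (B : set T) : set T := [set x | forall y, B y -> r x y].

Definition upper_cone (B : set T) : set T := [set x | forall y, B y -> r y x].

Definition below (B C : set T) : Prop := forall x y, B x -> C y -> r x y.

Definition is_poset : Prop := [/\ reflexive r, antisymmetric r & transitive r].

Definition antitone_involution (n : T -> T) : Prop :=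
  (forall x y, r x y -> r (n y) (n x)) /\ involutive n.

Definition pseudo_kleene_poset (n : T -> T) : Prop :=
  [/\ is_poset, antitone_involution n &
      forall x y,
        below (lower_cone [set x; n x]) (upper_cone [set y; n y])].

End Relations.

Lemma lower_cone_lbound d (A : porderType d) (B : set A) :
  lower_cone <=%O B = lbound B.
Proof. by []. Qed.

Lemma upper_cone_ubound d (A : porderType d) (B : set A) :
  upper_cone <=%O B = ubound B.
Proof. by []. Qed.

Section PS.
Variables (d : Order.disp_t) (A : porderType d) (S : set A).

Definition PSset : set (A * A) :=
  [set p | below <=%O (lower_cone <=%O [set p.1; p.2]) S /\
           below <=%O S (upper_cone <=%O [set p.1; p.2])].

Definition PS : Type := set_type PSset.

Definition PSpair (p : PS) : A * A := val p.

Definition PSfst (p : PS) : A := (PSpair p).1.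

Definition PSsnd (p : PS) : A := (PSpair p).2.

Definition PSle : rel PS :=
  fun p q => (PSfst p <= PSfst q) && (PSsnd q <= PSsnd p).

Lemma PSset_swap (p : PS) : (PSsnd p, PSfst p) \in PSset.
Proof.
by apply/mem_set; rewrite /PSset /= [[set _; _]]setUC; exact: set_valP p.
Qed.

Definition PSswap (p : PS) : PS := exist _ (PSsnd p, PSfst p) (PSset_swap p).

End PS.

(* Main.v *)
Require Import Defs.
From mathcomp Require Import all_boot all_order.
From mathcomp Require Import boolp classical_sets.

(** The order on [PS S] is the restriction of the product of the order of [A]
    with its dual, so its poset axioms, and the fact that swapping coordinates
    is an antitone involution, hold coordinatewise; a cone of a set [X] in a
    product is the product of the cones of the two projections of [X], the dual
    second factor exchanging lower and upper cones, and a cone in [PS S] is the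
    trace of such a product on [PSset S] ([image_PSpair]).

    The pseudo-Kleene condition is where membership in [PSset S] matters: if
    [a] lies below [p] and its swap, then [a.1] is a lower bound, and [a.2] an
    upper bound, of the two coordinates of [p], so that [a.1 <= S <= a.2]
    ([lower_cone_swap]). Dually [b.2 <= S <= b.1] for [b] above some [q] and its
    swap ([upper_cone_swap]). Any element of [S] then sits between [a.1] and
    [b.1] and between [b.2] and [a.2], whence [a] is below [b]. *)

Import Order.TTheory.
Local Open Scope order_scope.
Local Open Scope classical_set_scope.

Section PairPoset.
Variables (d : Order.disp_t) (A : porderType d) (S : set A).
Implicit Types (p q a b : PS S) (X : set (PS S)).

Lemma PSpair_inj : injective (@PSpair d A S).
Proof. exact: val_inj. Qed.

Lemma PSle_poset : is_poset (@PSle d A S).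
Proof.
split.
- by move=> p; rewrite /PSle !lexx.
- move=> p q /andP[/andP[le1 ge2] /andP[ge1 le2]]; apply: PSpair_inj.
  rewrite [PSpair p]surjective_pairing [PSpair q]surjective_pairing.
  by congr pair; apply: le_anti; rewrite ?le1 ?le2.
- move=> q p r /andP[pq1 qp2] /andP[qr1 rq2].
  by rewrite /PSle (le_trans pq1 qr1) (le_trans rq2 qp2).
Qed.

Lemma PSswap_antitone_involution :
  antitone_involution (@PSle d A S) (@PSswap d A S).
Proof.
split=> [p q /andP[le1 le2] | p]; first by apply/andP.
by apply: PSpair_inj; rewrite [RHS]surjective_pairing.
Qed.

(** Being below both [p] and its swap puts both coordinates of [p] between
    [PSfst a] and [PSsnd a], so the two halves of [p \in PSset S] apply to
    [PSfst a] as a lower bound and to [PSsnd a] as an upper bound. *)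
Lemma lower_cone_swap p a :
    lower_cone (@PSle d A S) [set p; PSswap p] a ->
  forall s, S s -> PSfst a <= s <= PSsnd a.
Proof.
move=> ap s Ss; have [lowS upS] := set_valP p.
have /andP[a1p1 p2a2] : PSle a p by apply: ap; left.
have /andP[a1p2 p1a2] : PSle a (PSswap p) by apply: ap; right.
apply/andP; split; first by apply: lowS Ss => y [->|->].
by apply: (upS s _ Ss) => y [->|->].
Qed.

(** The swap is an antitone involution, so [lower_cone_swap] dualises by
    applying it to the swap of [b]. *)
Lemma upper_cone_swap q b :
    upper_cone (@PSle d A S) [set q; PSswap q] b ->
  forall s, S s -> PSsnd b <= s <= PSfst b.
Proof.
have [swapN swapK] := PSswap_antitone_involution.
move=> qb; apply: (@lower_cone_swap q (PSswap b)) => y [->|->].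
  by rewrite -[q]swapK; apply: swapN; apply: qb; right.
by apply: swapN; apply: qb; left.
Qed.

Lemma PS_pseudo_kleene :
  S !=set0 -> pseudo_kleene_poset (@PSle d A S) (@PSswap d A S).
Proof.
move=> [s Ss]; split; [exact: PSle_poset | exact: PSswap_antitone_involution |].
move=> p q a b /lower_cone_swap/(_ s Ss)/andP[a1s sa2].
move=> /upper_cone_swap/(_ s Ss)/andP[b2s sb1].
by rewrite /PSle (le_trans a1s sb1) (le_trans b2s sa2).
Qed.

(** Both cone formulas describe membership by a condition on the underlying
    pair; this turns such a description into an equality of subsets of
    [A * A]. *)
Lemma image_PSpair (Y : set (PS S)) (Q : set (A * A)) :
  (forall p, Y p <-> Q (PSpair p)) -> @PSpair d A S @` Y = Q `&` PSset S.
Proof.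
move=> YQ; apply/seteqP; split=> [_ [p /YQ Qp <-] | x [Qx Sx]].
  by split=> //; exact: set_valP p.
by exists (exist _ x (mem_set Sx)) => //; apply/YQ.
Qed.

Lemma image_lower_cone X :
  @PSpair d A S @` lower_cone (@PSle d A S) X =
    (lower_cone <=%O (@PSfst d A S @` X) `*`
     upper_cone <=%O (@PSsnd d A S @` X)) `&` PSset S.
Proof.
apply: image_PSpair => p; split=> [pX | [p1X p2X] q Xq].
  by split=> _ [q /pX/andP[pq1 qp2] <-].
by apply/andP; split; [apply: p1X | apply: p2X]; exists q.
Qed.

Lemma image_upper_cone X :
  @PSpair d A S @` upper_cone (@PSle d A S) X =
    (upper_cone <=%O (@PSfst d A S @` X) `*`
     lower_cone <=%O (@PSsnd d A S @` X)) `&` PSset S.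
Proof.
apply: image_PSpair => p; split=> [Xp | [p1X p2X] q Xq].
  by split=> _ [q /Xp/andP[qp1 pq2] <-].
by apply/andP; split; [apply: p1X | apply: p2X]; exists q.
Qed.

End PairPoset.

Theorem lemma2p3 (d : Order.disp_t) (A : porderType d) (S : set A)
    (S_neq0 : S !=set0) :
  pseudo_kleene_poset (@PSle d A S) (@PSswap d A S) /\
  forall X : set (PS S),
    @PSpair d A S @` lower_cone (@PSle d A S) X =
      (lower_cone <=%O (@PSfst d A S @` X) `*`
       upper_cone <=%O (@PSsnd d A S @` X)) `&` PSset S /\
    @PSpair d A S @` upper_cone (@PSle d A S) X =
      (upper_cone <=%O (@PSfst d A S @` X) `*`
       lower_cone <=%O (@PSsnd d A S @` X)) `&` PSset S.
Proof.
split; first exact: PS_pseudo_kleene.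
by move=> X; split; [exact: image_lower_cone | exact: image_upper_cone].
Qed.
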